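(* There exists a continuous non-affine function $g:\mathbb R\to\mathbb R$ such that, for every compact set $K\subset\mathbb R$, the class $\mathcal S$ of functions obtained from $g$ by repeated addition and composition is dense in $C(K)$; that is, for every $f\in C(K)$ and every $\varepsilon>0$ there exists $F\in\mathcal S$ such that $\sup_{x\in K}|f(x)-F(x)|<\varepsilon$.
   Context: A function $g:\mathbb R\to\mathbb R$ is affine if it has the form $g(t)=at+b$ with $a,b\in\mathbb R$ (including constant functions), and non-affine otherwise. $C(K)$ denotes the space of real-valued continuous functions on $K$ with the uniform norm. The class of functions obtained from $g$ by repeated addition and composition is the smallest set $\mathcal S$ of functions $\mathbb R\to\mathbb R$ such that $g\in\mathcal S$ and, whenever $f,h\in\mathcal S$, also $f+h\in\mathcal S$ (pointwise sum) and $f\circ h\in\mathcal S$. Multiplication by constants is not assumed, and the identity function and constant functions are not assumed to be in $\mathcal S$ a priori. *)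

(* Defs.v *)
From mathcomp Require Import all_boot all_order all_algebra.
From mathcomp Require Import all_classical all_reals all_analysis.

Set Implicit Arguments.
Unset Strict Implicit.
Unset Printing Implicit Defensive.

Import Order.TTheory GRing.Theory Num.Theory.
Import numFieldNormedType.Exports.

Local Open Scope classical_set_scope.
Local Open Scope ring_scope.

Definition affine_fun (R : realType) (g : R -> R) : Prop :=
  exists a b : R, forall t : R, g t = a * t + b.

Inductive sum_comp_class (R : realType) (g : R -> R) : set (R -> R) :=
| scc_gen : sum_comp_class g g
| scc_add (f h : R -> R) :
    sum_comp_class g f -> sum_comp_class g h -> sum_comp_class g (f \+ h)
| scc_comp (f h : R -> R) :
    sum_comp_class g f -> sum_comp_class g h -> sum_comp_class g (f \o h).

(* An element of C(K) is represented by any f : R -> R whose restriction to K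
   is continuous for the subspace topology; values of f off K are irrelevant.
   The supremum is taken in the extended reals, so that it is a genuine least
   upper bound for every K (it is -oo when K is empty). *)
Definition dense_in_C (R : realType) (S : set (R -> R)) (K : set R) : Prop :=
  forall f : R -> R, {within K, continuous f} ->
  forall eps : R, 0 < eps ->
  exists2 F : R -> R, S F &
    (ereal_sup [set `|f x - F x|%:E | x in K] < eps%:E)%E.

(* Main.v *)
Require Import Defs.
From mathcomp Require Import all_boot all_order all_algebra.
From mathcomp Require Import all_classical all_reals all_analysis.
From mathcomp Require Import ring lra.

Set Implicit Arguments.
Unset Strict Implicit.
Unset Printing Implicit Defensive.

Import Order.TTheory GRing.Theory Num.Theory.
Import numFieldNormedType.Exports.

Local Open Scope classical_set_scope.
Local Open Scope ring_scope.

(** Every element of the class factors as F \o g, so a suitable g has to be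
    injective, hence strictly monotone, and even decreasing, since sums and
    compositions of increasing functions are increasing.  The function taken
    here is the decreasing piecewise affine involution [kink], with slopes
    -1/2 and -2 on the two sides of its fixed point -1/3.

    Being an involution, it puts the identity in the class ([sum_comp_id]).
    The fixed point and the slopes are chosen so that V = x + g(x) is a tent
    function lying entirely to the left of the kink, where v + 2 g(v) = -1:
    substituting V produces the constant -1 ([sum_comp_cstN1]), and constants
    can then be used as translations.

    On a given set K, consider the bounded functions that are uniform limits
    of elements of the class ([approximable]).  As g is Lipschitz, they are
    stable under f |-> g \o f.  Translating a bounded f far to the left of the
    kink, applying g and translating back gives - f / 2
    ([approximableNhalf]); iterating gives all dyadic multiples of f, and
    passing to the limit all real multiples ([approximableZ]).  So these
    functions form a vector space containing the affine functions, and once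
    affine terms are subtracted, the kink of g is the operation
    v |-> min 0 v; the space is therefore stable under minima and absolute
    values.

    Density then follows as in the lattice form of the Stone-Weierstrass
    theorem: a continuous f on a compact K is approximated by the minimum of
    finitely many cones x |-> f y + e + L `|x - y|, each steep enough to lie
    above f on K and close to f near its apex
    ([approximable_continuous]). *)

(** * The kinked involution *)

(** The minimum of two lines, which are inverse functions of each other
    and meet on the diagonal at -1/3. *)
Definition kink (R : realType) (x : R) : R :=
  Num.min (- 1 - 2 * x) (- (1 + x) / 2).

Lemma kink_left (R : realType) (x : R) :
  x <= - (1 / 3) -> kink x = - (1 + x) / 2.
Proof. by move=> hx; apply/min_idPr; lra. Qed.

Lemma kink_right (R : realType) (x : R) :
  - (1 / 3) <= x -> kink x = - 1 - 2 * x.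
Proof. by move=> hx; apply/min_idPl; lra. Qed.

Lemma kinkK (R : realType) : involutive (@kink R).
Proof.
move=> x; case: (leP x (- (1 / 3))) => hx.
  by rewrite (kink_left hx) kink_right; lra.
by rewrite (kink_right (ltW hx)) kink_left; lra.
Qed.

Lemma kink_lipschitz (R : realType) (x y : R) :
  `|kink x - kink y| <= 2 * `|x - y|.
Proof.
wlog xy : x y / x <= y => [H|].
  case: (leP x y) => [/H//|/ltW /H]; by rewrite distrC (distrC y).
rewrite (distrC x) (ger0_norm (x := y - x)) ?subr_ge0// ler_norml.
case: (leP x (- (1 / 3))) => hx; last first.
  by rewrite !kink_right; lra.
rewrite (kink_left hx); case: (leP y (- (1 / 3))) => hy.
  by rewrite (kink_left hy); lra.
by rewrite (kink_right (ltW hy)); lra.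
Qed.

Lemma kink_continuous (R : realType) : continuous (@kink R).
Proof.
move=> x; apply/cvgrPdist_lt => e e0.
near=> y; apply: le_lt_trans (kink_lipschitz x y) _.
rewrite -ltr_pdivlMl//; near: y.
have e2 : 0 < 2^-1 * e by rewrite mulr_gt0// invr_gt0.
by exists (2^-1 * e).
Unshelve. all: by end_near. Qed.

Lemma kink_not_affine (R : realType) : ~ affine_fun (@kink R).
Proof.
move=> [a [b h]]; move: (h (-1)) (h 0) (h 1).
by rewrite kink_left ?kink_right; lra.
Qed.

(** * Exact members of the class *)

Lemma sum_comp_id (R : realType) : sum_comp_class (@kink R) id.
Proof.
have -> : id = @kink R \o @kink R by apply/funext => x /=; rewrite kinkK.
by apply: scc_comp; exact: scc_gen.
Qed.

(** T(v) = v + 2 g(v) is equal to -1 on the half-line v <= -1/3, and the tent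
    V(x) = x + g(x) never exceeds V(-1/3) = -2/3: hence T \o V = -1. *)
Lemma sum_comp_cstN1 (R : realType) : sum_comp_class (@kink R) (cst (-1)).
Proof.
pose V : R -> R := id \+ @kink R.
pose T : R -> R := V \+ @kink R.
have SV : sum_comp_class (@kink R) V.
  by apply: scc_add (sum_comp_id R) _; exact: scc_gen.
have -> : cst (-1) = T \o V.
  apply/funext => x /=.
  have hV : V x <= - (1 / 3).
    rewrite /V /=; case: (leP x (- (1 / 3))) => hx.
      by rewrite (kink_left hx); lra.
    by rewrite (kink_right (ltW hx)); lra.
  by move: (V x) hV => v hv; rewrite /T /V /= (kink_left hv); lra.
exact: (scc_comp (scc_add SV (scc_gen _)) SV).
Qed.

(** * The uniform closure on a set *)

(** Boundedness is part of the definition because the arguments below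
    translate f beyond the kink, and replace real scalars by dyadic ones, which
    is harmless only for bounded f. *)
Definition approximable (R : realType) (K : set R) (f : R -> R) : Prop :=
  (exists B : R, forall x, K x -> `|f x| <= B) /\
  forall eps : R, 0 < eps -> exists2 F, sum_comp_class (@kink R) F &
    forall x, K x -> `|f x - F x| <= eps.

Section Closure.
Variables (R : realType) (K : set R).
Implicit Types (f h : R -> R).
Local Notation E := (approximable K).

Lemma approximable_closed f :
  (forall eps : R, 0 < eps -> exists2 h, E h & forall x, K x -> `|f x - h x| <= eps) ->
  E f.
Proof.
move=> H; split.
  have [h [[B hB] _] fh] := H 1 ltr01.
  exists (1 + B) => x Kx; rewrite -[f x](subrK (h x)).
  by apply: le_trans (ler_normD _ _) _; rewrite lerD ?fh ?hB.
move=> e e0; have e2 : 0 < e / 2 by rewrite divr_gt0.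
have [h [_ hS] fh] := H _ e2; have [F SF hF] := hS _ e2.
exists F => // x Kx; rewrite -[f x](subrK (h x)) -addrA.
by apply: le_trans (ler_normD _ _) _; rewrite [leRHS]splitr lerD ?fh ?hF.
Qed.

Lemma eq_approximable f h : (forall x, K x -> f x = h x) -> E f -> E h.
Proof.
move=> fh Ef; apply: approximable_closed => e e0; exists f => // x Kx.
by rewrite fh// subrr normr0 ltW.
Qed.

Lemma approximableD f h : E f -> E h -> E (f \+ h).
Proof.
move=> [[B fB] fS] [[C hC] hS]; split.
  exists (B + C) => x Kx.
  by apply: le_trans (ler_normD _ _) _; rewrite lerD ?fB ?hC.
move=> e e0; have e2 : 0 < e / 2 by rewrite divr_gt0.
have [F SF fF] := fS _ e2; have [H SH hH] := hS _ e2.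
exists (F \+ H); first exact: scc_add.
move=> x Kx /=; rewrite opprD addrACA [leRHS]splitr.
by apply: le_trans (ler_normD _ _) _; rewrite lerD ?fF ?hH.
Qed.

(** Stability under composition with g alone is enough, and it only uses
    that g is 2-Lipschitz. *)
Lemma approximable_kink f : E f -> E (@kink R \o f).
Proof.
move=> [[B fB] fS]; split.
  exists (1 + 2 * B) => x Kx /=.
  have /= := kink_lipschitz (f x) 0; rewrite subr0 (kink_right (x := 0)); last lra.
  move: (fB x Kx); rewrite mulr0 subr0 opprK => fx kx.
  have := ler_normD (kink (f x) + 1) (- 1); rewrite addrK normrN1; lra.
move=> e e0; have [|F SF fF] := fS (e / 2); first by rewrite divr_gt0.
exists (@kink R \o F); first by apply: scc_comp SF; exact: scc_gen.
move=> x Kx /=; apply: le_trans (kink_lipschitz _ _) _.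
by rewrite mulrC -ler_pdivlMr// fF.
Qed.

Lemma approximable_cstN1 : E (cst (-1)).
Proof.
split; first by exists 1 => x _; rewrite normrN1.
by move=> e e0; exists (cst (-1)); [exact: sum_comp_cstN1|move=> x _; rewrite subrr normr0 ltW].
Qed.

Lemma approximable_id (B : R) : (forall x, K x -> `|x| <= B) -> E id.
Proof.
move=> KB; split; first by exists B.
by move=> e e0; exists id; [exact: sum_comp_id|move=> x _; rewrite subrr normr0 ltW].
Qed.

Lemma approximable_subn f (n : nat) : E f -> E (fun x => f x - n%:R).
Proof.
move=> Ef; elim: n => [|n IHn].
  by apply: eq_approximable Ef => x _; rewrite subr0.
apply: eq_approximable (approximableD IHn approximable_cstN1) => x _ /=.
by rewrite -natr1; ring.
Qed.

(** If f <= m on K, then f - (2 m + 1) stays to the left of the kink, where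
    g(v) = - (1 + v) / 2; the value of g there is - f / 2 + m.  The odd
    translation makes the correction m an integer, so that it can be undone
    with copies of the constant -1. *)
Lemma approximableNhalf f : E f -> E (fun x => - (f x / 2)).
Proof.
move=> Ef; have [B fB] := Ef.1.
have [m mB] : exists m : nat, B <= m%:R.
  exists (Num.bound `|B|); apply: le_trans (ler_norm B) (ltW _).
  by apply: archi_boundP.
have := approximable_subn m (approximable_kink (approximable_subn (m.*2.+1) Ef)).
apply: eq_approximable => x Kx /=.
have := fB x Kx; rewrite ler_norml => /andP[_ fx].
have m0 : 0 <= m%:R :> R by [].
by rewrite -muln2 -natr1 natrM kink_left; lra.
Qed.

Lemma approximableN f : E f -> E (fun x => - f x).
Proof.
move=> /approximableNhalf Ef.
by apply: eq_approximable (approximableD Ef Ef) => x _ /=; field.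
Qed.

Lemma approximable_half f : E f -> E (fun x => f x / 2).
Proof.
move=> /approximableNhalf/approximableN.
by apply: eq_approximable => x _; rewrite opprK.
Qed.

Lemma approximable0 : E (cst 0).
Proof.
apply: eq_approximable (approximableD (approximableN approximable_cstN1) approximable_cstN1).
by move=> x _ /=; rewrite opprK subrr.
Qed.

(** Negation is twice f |-> - f / 2, and halving is the negation of that map;
    sums give the integer numerators. *)
Lemma approximable_dyadic f (z : int) (k : nat) :
  E f -> E (fun x => z%:~R / 2 ^+ k * f x).
Proof.
move=> Ef; elim: k => [|k IHk]; last first.
  by apply: eq_approximable (approximable_half IHk) => x _; rewrite exprS; field; rewrite expf_neq0.
have nat_mul (n : nat) : E (fun x => n%:R * f x).
  elim: n => [|n IHn].
    by apply: eq_approximable approximable0 => x _; rewrite mul0r.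
  by apply: eq_approximable (approximableD IHn Ef) => x _ /=; rewrite -natr1; ring.
case: z => n.
  by apply: eq_approximable (nat_mul n) => x _; rewrite expr0 divr1.
apply: eq_approximable (approximableN (nat_mul n.+1)) => x _.
by rewrite expr0 divr1 NegzE mulrNz mulNr.
Qed.

Lemma dyadic_dense (a e : R) : 0 < e ->
  exists (z : int) (k : nat), `|a - z%:~R / 2 ^+ k| <= e.
Proof.
move=> e0.
have [k ke] : exists k, 1 / 2 ^+ k < e.
  have [k _ /(_ k (leqnn k)) hk] := near_infty_natSinv_expn_lt (PosNum e0).
  by exists k.
exists (Num.floor (a * 2 ^+ k)), k; apply: le_trans (ltW ke).
have p0 : 0 < 2 ^+ k :> R by rewrite exprn_gt0.
have /andP[h1 h2] := floor_itv (a * 2 ^+ k).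
rewrite ger0_norm; last by rewrite subr_ge0 ler_pdivrMr.
by rewrite lerBlDr -mulrDl ler_pdivlMr// addrC -intrD1 ltW.
Qed.

Lemma approximableZ (a : R) f : E f -> E (fun x => a * f x).
Proof.
move=> Ef; apply: approximable_closed => e e0; have [B fB] := Ef.1.
have B0 : 0 < `|B| + 1 by rewrite ltr_wpDl.
have [z [k azk]] := dyadic_dense a (divr_gt0 e0 B0).
exists (fun x => z%:~R / 2 ^+ k * f x); first exact: approximable_dyadic.
move=> x Kx; rewrite -mulrBl normrM -(divfK (lt0r_neq0 B0) e) ler_pM//.
by apply: le_trans (fB x Kx) _; rewrite ler_wpDr// ler_norm.
Qed.

Lemma approximable_cst (a : R) : E (cst a).
Proof.
by apply: eq_approximable (approximableZ (- a) approximable_cstN1) => x _; rewrite /cst /=; ring.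
Qed.

(** g(u) = - (1 + u) / 2 + min 0 (- (1 + 3 u) / 2); the affine substitution
    u = - (1 + 2 v) / 3 turns the second term into min 0 v. *)
Lemma approximable_min0 f : E f -> E (fun x => Num.min 0 (f x)).
Proof.
move=> Ef.
have Eaff (a b : R) : E (fun x => a * f x + b).
  exact: approximableD (approximableZ a Ef) (approximable_cst b).
have := approximableD (approximable_kink (Eaff (- (2 / 3)) (- (1 / 3))))
                      (Eaff (- (1 / 3)) (1 / 3)).
apply: eq_approximable => x _ /=; case: (leP 0 (f x)) => fx.
  by rewrite kink_left; lra.
by rewrite kink_right; lra.
Qed.

Lemma approximable_min f h : E f -> E h -> E (fun x => Num.min (f x) (h x)).
Proof.
move=> Ef Eh.
have := approximableD Ef (approximable_min0 (approximableD Eh (approximableN Ef))).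
by apply: eq_approximable => x _ /=; rewrite addr_minr addr0 subrKC.
Qed.

Lemma approximable_norm f : E f -> E (fun x => `|f x|).
Proof.
move=> Ef; have := approximableD Ef (approximableZ (- 2) (approximable_min0 Ef)).
apply: eq_approximable => x _ /=; case: (leP 0 (f x)) => fx.
  by rewrite ger0_norm//; ring.
by rewrite ltr0_norm//; ring.
Qed.

Lemma approximable_bigmin (I : Type) (s : seq I) (B : R) (u : I -> R -> R) :
  (forall i, E (u i)) -> E (fun x => \big[Num.min/B]_(i <- s) u i x).
Proof.
move=> Eu; elim: s => [|i s IHs].
  by apply: eq_approximable (approximable_cst B) => x _; rewrite big_nil.
by apply: eq_approximable (approximable_min (Eu i) IHs) => x _; rewrite big_cons.
Qed.

(** * Density on compact sets *)

(** Let B bound |f| on K and let d y be a modulus of continuity of f at y for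
    the tolerance e / 3.  The cone of apex (y, f y + e / 3) and slope
    2 B / d y is above f within distance d y by continuity, and beyond it
    because the cone has risen by 2 B, the largest oscillation of f.  On a
    smaller ball around y it is below f + e; finitely many of these balls cover
    K, and the minimum of the corresponding cones is within e of f. *)
Lemma approximable_continuous f :
  compact K -> {within K, continuous f} -> E f.
Proof.
move=> cK cf; apply: approximable_closed => e e0.
have bounded (A : set R) : compact A -> exists2 M : R, 0 < M & forall x, A x -> `|x| <= M.
  move=> /compact_bounded [M [_ AM]].
  exists (`|M| + 1) => [|x Ax]; first by rewrite ltr_wpDl.
  by apply: AM Ax; rewrite (le_lt_trans (ler_norm M)) ?ltrDl.
have [M M0 KM] := bounded _ cK.
have [B B0 fB'] := bounded _ (continuous_compact cf cK).
have fB x : K x -> `|f x| <= B by move=> Kx; apply: fB'; exists x.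
have e3 : 0 < e / 3 by rewrite divr_gt0.
(* A positive radius is also given to points outside K, so that d is total. *)
have /choice [d dP] : forall y, exists d : R, 0 < d /\
    (K y -> forall x, K x -> `|y - x| < d -> `|f y - f x| <= e / 3).
  move=> y; have [Ky|nKy] := pselect (K y); last by exists 1.
  move/subspace_continuousP : cf => /(_ y Ky)/cvgrPdist_le/(_ _ e3).
  rewrite near_withinE => /nbhs_ballP [d /= d0 dy]; exists d; split => // _ x Kx xy.
  exact: dy.
have d0 y : 0 < d y by case: (dP y).
pose u y x := f y + e / 3 + 2 * B / d y * `|x - y|.
have Eu y : E (u y).
  apply: approximableD (approximable_cst _) (approximableZ _ (approximable_norm _)).
  exact: approximableD (approximable_id KM) (approximable_cst _).
have fu y x : K y -> K x -> f x <= u y x.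
  move=> Ky Kx; rewrite /u.
  have Bd : 0 <= 2 * B / d y by rewrite divr_ge0 ?mulr_ge0 ?ltW.
  have [xy|xy] := ltP `|y - x| (d y).
    have := (dP y).2 Ky x Kx xy; rewrite ler_norml => /andP[+ _].
    have : 0 <= 2 * B / d y * `|x - y| by rewrite mulr_ge0.
    by lra.
  have : 2 * B <= 2 * B / d y * `|x - y|.
    rewrite -mulrA ler_peMr ?mulr_ge0 ?(ltW B0)// mulrC ler_pdivlMr//.
    by rewrite mul1r distrC.
  move: (fB x Kx) (fB y Ky); rewrite !ler_norml => /andP[_ +] /andP[+ _].
  by lra.
(* Within r y, continuity costs e / 3, the apex offset e / 3, and the slope
   e / 3. *)
pose r y := Num.min (d y) (e / 3 / (2 * B / d y)).
have r0 y : 0 < r y by rewrite lt_min d0 !divr_gt0 ?mulr_gt0.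
have near_center y x : K y -> K x -> `|y - x| < r y -> u y x <= f x + e.
  move=> Ky Kx; rewrite lt_min => /andP[xd].
  rewrite ltr_pdivlMr ?divr_gt0 ?mulr_gt0// mulrC distrC => xe.
  have := (dP y).2 Ky x Kx xd.
  by rewrite ler_norml => /andP[_ fyx]; rewrite /u; lra.
have := cK; rewrite compact_cover => /(_ R K (fun y => ball y (r y))).
case=> [y _|x Kx|D DK KD].
- exact: ball_open.
- by exists x => //; exact: ballxx.
(* B is above f on K, so it is a neutral start for the minimum, also when K is
   empty. *)
exists (fun x => \big[Num.min/B]_(y <- finmap.enum_fset D) u y x); first exact: approximable_bigmin.
move=> x Kx.
have fmin : f x <= \big[Num.min/B]_(y <- finmap.enum_fset D) u y x.
  rewrite big_seq; apply: le_bigmin => [|y yD].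
    by apply: le_trans (fB x Kx); exact: ler_norm.
  by apply: fu => //; have := DK y yD; rewrite inE.
rewrite ler0_norm ?subr_le0// opprB lerBlDl.
have [y yD yx] := KD x Kx.
have Ky : K y by have := DK y yD; rewrite inE.
have := near_center y x Ky Kx yx.
apply: le_trans; exact: bigmin_inf_seq yD _ _.
Qed.

End Closure.

Theorem corollary4p1 (R : realType) :
  exists g : R -> R,
    [/\ continuous g, ~ affine_fun g &
        forall K : set R, compact K -> dense_in_C (sum_comp_class g) K].
Proof.
exists (@kink R); split; [exact: kink_continuous|exact: kink_not_affine|].
move=> K cK f cf e e0.
have [|F SF fF] := (approximable_continuous cK cf).2 (e / 2); first by rewrite divr_gt0.
exists F => //; apply: (@le_lt_trans _ _ (e / 2)%:E); last first.
  by rewrite lte_fin ltr_pdivrMr// ltr_pMr// ltr1n.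
by apply: ge_ereal_sup => _ [x Kx <-]; rewrite lee_fin fF.
Qed.
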